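(* Let $\lambda$ be a nonzero real number and $r$ a positive integer. For every integer $n\ge 0$ (and every real $x$), $$\sum_{k=0}^{n}C_{k}^{(r)}(x)\,S_{1,\lambda}(n,k)=\sum_{k=0}^{n}\mathcal{E}_{k,\lambda}^{(r)}(x)\,S_{J,\lambda}^{(1)}(n,k).$$ In particular, $$\sum_{k=0}^{n}C_{k}^{(r)}\,S_{1,\lambda}(n,k)=\sum_{k=0}^{n}\mathcal{E}_{k,\lambda}^{(r)}\,S_{J,\lambda}^{(1)}(n,k).$$
   Context: All generating functions are formal power series in $t$ with real coefficients. For $x\in\mathbb{R}$: $(x)_0=1$, $(x)_n=x(x-1)\cdots(x-n+1)$ for $n\ge1$; $(x)_{0,\lambda}=1$, $(x)_{n,\lambda}=x(x-\lambda)\cdots(x-(n-1)\lambda)$ for $n\ge 1$. The degenerate exponential is $e_\lambda^x(t)=(1+\lambda t)^{x/\lambda}=\sum_{n\ge0}(x)_{n,\lambda}\frac{t^n}{n!}$, $e_\lambda(t)=e_\lambda^1(t)$ (and $e_\lambda^{-1}(t)$ is the case $x=-1$). The degenerate logarithm is $\log_\lambda(1+t)=\frac{1}{\lambda}\left((1+t)^\lambda-1\right)$, so that $e_\lambda(\log_\lambda(1+t))=1+t$. The degenerate Stirling numbers of the first kind $S_{1,\lambda}(n,l)$ are defined by $(x)_n=\sum_{l=0}^n S_{1,\lambda}(n,l)(x)_{l,\lambda}$ (polynomial identity in $x$, $n\ge0$). The Jindalrae-Stirling numbers of the first kind are defined, for $k\ge0$, by $\frac{1}{k!}\left(\log_\lambda(1+\log_\lambda(1+t))\right)^k=\sum_{n\ge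 k}S_{J,\lambda}^{(1)}(n,k)\frac{t^n}{n!}$. The type 2 degenerate Euler polynomials of order $r$ are defined by $\left(\frac{2}{e_\lambda(t)+e_\lambda^{-1}(t)}\right)^r e_\lambda^x(t)=\sum_{n\ge0}\mathcal{E}_{n,\lambda}^{(r)}(x)\frac{t^n}{n!}$, and $\mathcal{E}_{n,\lambda}^{(r)}=\mathcal{E}_{n,\lambda}^{(r)}(0)$. The type 2 Changhee polynomials of order $r$ are defined by $\left(\frac{2}{(1+t)+(1+t)^{-1}}\right)^r(1+t)^x=\sum_{n\ge0}C_n^{(r)}(x)\frac{t^n}{n!}$, and $C_n^{(r)}=C_n^{(r)}(0)$. *)

(* Defs.v *)
From HB Require Import structures.
From mathcomp Require Import all_boot all_order all_algebra.
From mathcomp Require Import boolp reals.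

Set Implicit Arguments.
Unset Strict Implicit.
Unset Printing Implicit Defensive.

Import Order.TTheory GRing.Theory Num.Theory.
Local Open Scope ring_scope.

(* A formal power series [f] is its coefficient sequence: [f n] is the
   coefficient of t^n. Equality is Leibniz equality (see [fpsP]). *)
Record fps (F : Type) := Fps { fps_coef :> nat -> F }.

HB.instance Definition _ (F : Type) := gen_eqMixin (fps F).
HB.instance Definition _ (F : Type) := gen_choiceMixin (fps F).

Lemma fpsP (F : Type) (f g : fps F) : (forall n, f n = g n) <-> f = g.
Proof.
split=> [|-> //]; case: f => f; case: g => g /= fg; congr Fps.
exact/funext.
Qed.

Section FpsRing.
Variable F : fieldType.
Implicit Types f g h : fps F.

Definition fps_zero : fps F := Fps (fun=> 0).
Definition fps_one : fps F := Fps (fun n => (n == 0%N)%:R).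
Definition fps_opp f : fps F := Fps (fun n => - f n).
Definition fps_add f g : fps F := Fps (fun n => f n + g n).
Definition fps_mul f g : fps F :=
  Fps (fun n => \sum_(i < n.+1) f i * g (n - i)%N).
Definition fps_scale (a : F) f : fps F := Fps (fun n => a * f n).

Fact fps_addA : associative fps_add.
Proof. by move=> f g h; apply/fpsP => n /=; rewrite addrA. Qed.
Fact fps_addC : commutative fps_add.
Proof. by move=> f g; apply/fpsP => n /=; rewrite addrC. Qed.
Fact fps_add0 : left_id fps_zero fps_add.
Proof. by move=> f; apply/fpsP => n /=; rewrite add0r. Qed.
Fact fps_addN : left_inverse fps_zero fps_opp fps_add.
Proof. by move=> f; apply/fpsP => n /=; rewrite addNr. Qed.

HB.instance Definition _ :=
  GRing.isZmodule.Build (fps F) fps_addA fps_addC fps_add0 fps_addN.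

Let trunc N f : {poly F} := \poly_(i < N) f i.

Let fps_mul_trunc N f g n : (n < N)%N ->
  fps_mul f g n = (trunc N f * trunc N g)`_n.
Proof.
move=> nN; rewrite coefM /=; apply: eq_bigr => i _.
have iN : (i < N)%N by rewrite (leq_trans (ltn_ord i)).
by rewrite /trunc !coef_poly iN (leq_ltn_trans (leq_subr _ _) nN).
Qed.

Fact fps_mulA : associative fps_mul.
Proof.
move=> f g h; apply/fpsP => n.
transitivity ((trunc n.+1 f * (trunc n.+1 g * trunc n.+1 h))`_n).
  rewrite coefM; apply: eq_bigr => i _.
  have le_in : (i < n.+1)%N := ltn_ord i.
  have lt_nin : (n - i < n.+1)%N by rewrite ltnS leq_subr.
  by rewrite (fps_mul_trunc _ _ lt_nin) /trunc coef_poly le_in.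
rewrite mulrA coefM; apply: eq_bigr => i _.
have lt_nin : (n - i < n.+1)%N by rewrite ltnS leq_subr.
by rewrite (fps_mul_trunc _ _ (ltn_ord i)) /trunc [X in _ * X = _]coef_poly lt_nin.
Qed.

Fact fps_mulC : commutative fps_mul.
Proof.
move=> f g; apply/fpsP => n.
by rewrite !(@fps_mul_trunc n.+1) // mulrC.
Qed.

Fact fps_mul1 : left_id fps_one fps_mul.
Proof.
move=> f; apply/fpsP => n /=.
by rewrite big_ord_recl big1 /= ?subn0 ?mul1r ?addr0 // => i _; rewrite mul0r.
Qed.

Fact fps_mulDl : left_distributive fps_mul fps_add.
Proof.
move=> f g h; apply/fpsP => n /=; rewrite -big_split /=.
by apply: eq_bigr => i _; rewrite mulrDl.
Qed.

Fact fps_one_neq0 : fps_one != fps_zero.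
Proof. by apply/eqP => /fpsP/(_ 0%N)/eqP; rewrite /= oner_eq0. Qed.

HB.instance Definition _ :=
  GRing.Zmodule_isComNzRing.Build (fps F)
    fps_mulA fps_mulC fps_mul1 fps_mulDl fps_one_neq0.

Fact fps_scaleA a b f : fps_scale a (fps_scale b f) = fps_scale (a * b) f.
Proof. by apply/fpsP => n /=; rewrite mulrA. Qed.
Fact fps_scale1 : left_id 1 fps_scale.
Proof. by move=> f; apply/fpsP => n /=; rewrite mul1r. Qed.
Fact fps_scaleDr : right_distributive fps_scale +%R.
Proof. by move=> a f g; apply/fpsP => n /=; rewrite mulrDr. Qed.
Fact fps_scaleDl f : {morph fps_scale^~ f : a b / a + b}.
Proof. by move=> a b; apply/fpsP => n /=; rewrite mulrDl. Qed.

HB.instance Definition _ :=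
  GRing.Zmodule_isLmodule.Build F (fps F)
    fps_scaleA fps_scale1 fps_scaleDr fps_scaleDl.

Fact fps_scaleAl (a : F) f g : a *: (f * g) = (a *: f) * g.
Proof.
apply/fpsP => n /=; rewrite big_distrr /=.
by apply: eq_bigr => i _; rewrite mulrA.
Qed.

HB.instance Definition _ :=
  GRing.Lmodule_isLalgebra.Build F (fps F) fps_scaleAl.

(* The first [n] coefficients of the inverse of [f], obtained by solving
   f * g = 1 coefficientwise. *)
Fixpoint fps_inv_seq f n : seq F :=
  if n is m.+1 then
    let s := fps_inv_seq f m in
    rcons s ((f 0%N)^-1 * ((m == 0%N)%:R - \sum_(i < m) s`_i * f (m - i)%N))
  else [::].

Definition fps_unit : {pred fps F} := [pred f : fps F | f 0%N != 0].

(* As for every MathComp unit ring, the inverse of a non-unit is itself. *)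
Definition fps_inv f : fps F :=
  if f \in fps_unit then Fps (fun n => (fps_inv_seq f n.+1)`_n) else f.

Let size_inv_seq f n : size (fps_inv_seq f n) = n.
Proof. by elim: n => //= n IHn; rewrite size_rcons IHn. Qed.

Let nth_inv_seq f n i : (i < n)%N ->
  (fps_inv_seq f n)`_i = (fps_inv_seq f i.+1)`_i.
Proof.
elim: n => // n IHn; rewrite ltnS leq_eqVlt => /predU1P[-> //|lt_in].
by rewrite [LHS]/= nth_rcons size_inv_seq lt_in IHn.
Qed.

Fact fps_mulV : {in fps_unit, left_inverse 1 fps_inv *%R}.
Proof.
move=> f f0; apply/fpsP => n.
rewrite /fps_inv f0 [LHS]/= big_ord_recr /= nth_rcons size_inv_seq ltnn eqxx.
rewrite subnn mulrAC mulVf ?mul1r //.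
under eq_bigr => i _ do rewrite -/(fps_inv_seq f i.+1) -(nth_inv_seq _ (ltn_ord i)).
by rewrite addrC subrK.
Qed.

Fact fps_unitPl f g : g * f = 1 -> fps_unit f.
Proof.
move=> /fpsP/(_ 0%N)/=; rewrite big_ord1 subnn /= => gf1.
by apply/eqP => f0; move/eqP: gf1; rewrite f0 mulr0 eq_sym oner_eq0.
Qed.

Fact fps_inv_out : {in [predC fps_unit], fps_inv =1 id}.
Proof. by move=> f /negPf fN; rewrite /fps_inv fN. Qed.

HB.instance Definition _ :=
  GRing.ComNzRing_hasMulInverse.Build (fps F) fps_mulV fps_unitPl fps_inv_out.

Definition fps_X : fps F := Fps (fun n => (n == 1%N)%:R).

(* [fps_comp f g] is f(g(t)); it is meaningful when g has zero constant term,
   in which case g ^+ k has no term of degree < k, so that the terms with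
   k > n do not contribute to the coefficient of t^n. *)
Definition fps_comp f g : fps F :=
  Fps (fun n => \sum_(k < n.+1) f k * (g ^+ k) n).

(* The number a_n such that f = \sum_n a_n t^n / n!. *)
Definition egf_coef f (n : nat) : F := n`!%:R * f n.

End FpsRing.

(* (x)_{n,l} = x (x - l) ... (x - (n-1) l), in an arbitrary ring so that [x]
   may also be the polynomial variable. *)
Definition dfall (A : nzRingType) (l x : A) (n : nat) : A :=
  \prod_(i < n) (x - l *+ i).

Definition fall (A : nzRingType) (x : A) (n : nat) : A := dfall 1 x n.

Section Degenerate.
Variable R : realType.
Implicit Types (lam x : R) (r n k l : nat).

(* e_lam^x(t) *)
Definition dexp lam x : fps R := Fps (fun n => dfall lam x n / n`!%:R).

(* (1 + t)^x *)
Definition binser x : fps R := Fps (fun n => fall x n / n`!%:R).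

(* log_lam(1 + t), as a series in t *)
Definition dlog lam : fps R := lam^-1 *: (binser lam - 1).

Lemma ex_dstirling1 lam n : exists s : nat -> R,
  fall ('X : {poly R}) n = \sum_(l < n.+1) s l *: dfall lam%:P 'X l.
Proof.
elim: n => [|n [s IHn]].
  by exists (fun=> 1); rewrite big_ord1 scale1r /fall /dfall !big_ord0.
exists (fun l => (if l is l'.+1 then s l' else 0)
               + (if (l <= n)%N then s l * (lam *+ l - n%:R) else 0)).
rewrite /fall {1}/dfall big_ord_recr -/(dfall 1 'X n) -/(fall 'X n) IHn /=.
under [in RHS]eq_bigr => l _ do rewrite scalerDl.
rewrite [in RHS]big_split /= [X in _ = X + _]big_ord_recl /= scale0r add0r.
rewrite [X in _ = _ + X]big_ord_recr /= ltnn scale0r addr0 -big_split /=.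
rewrite big_distrl /=; apply: eq_bigr => l _; rewrite -ltnS ltn_ord.
rewrite [dfall _ _ (bump _ _)]big_ord_recr /= -/(dfall lam%:P 'X l).
rewrite -scalerA -scalerDr -scalerAl; congr (_ *: _).
rewrite -[X in _ = _ + X]mul_polyC [_%:P * _]mulrC -mulrDr; congr (_ * _).
by rewrite polyCB !polyCMn polyC1 addrA subrK.
Qed.

(* Degenerate Stirling numbers of the first kind: [dstirling1 lam n l], for
   l <= n, is the coefficient of (x)_{l,lam} in the expansion of (x)_n
   ([dstirling1P]); such coefficients are unique ([dstirling1_unique]).
   The value for l > n is not specified. *)
Definition dstirling1 lam n : nat -> R := sval (cid (ex_dstirling1 lam n)).

Lemma dstirling1P lam n :
  fall ('X : {poly R}) n = \sum_(l < n.+1) dstirling1 lam n l *: dfall lam%:P 'X l.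
Proof. exact: svalP (cid (ex_dstirling1 lam n)). Qed.

Lemma dstirling1_unique lam n (s : nat -> R) :
  fall ('X : {poly R}) n = \sum_(l < n.+1) s l *: dfall lam%:P 'X l ->
  forall l, (l <= n)%N -> s l = dstirling1 lam n l.
Proof.
move=> sP; suff c0 m (c : nat -> R) :
    \sum_(l < m.+1) c l *: dfall lam%:P 'X l = 0 ->
    forall l, (l <= m)%N -> c l = 0.
  move=> l ln; apply/eqP; rewrite -subr_eq0; apply/eqP.
  apply: (c0 n (fun l => s l - dstirling1 lam n l)) ln.
  under eq_bigr => i _ do rewrite scalerBl.
  by rewrite sumrB -sP -dstirling1P subrr.
have dfallE l : dfall lam%:P 'X l
    = \prod_(x <- [seq lam *+ i | i <- iota 0 l]) ('X - x%:P).
  have -> : iota 0 l = index_iota 0 l by rewrite /index_iota subn0.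
  rewrite big_map big_mkord /dfall.
  by apply: eq_bigr => i _; rewrite polyCMn.
have size_dfall l : size (dfall lam%:P ('X : {poly R}) l) = l.+1.
  by rewrite dfallE size_prod_XsubC size_map size_iota.
have lead_dfall l : (dfall lam%:P ('X : {poly R}) l)`_l = 1.
  have := monic_prod_XsubC [seq lam *+ i | i <- iota 0 l] xpredT id.
  by rewrite -dfallE monicE lead_coefE size_dfall => /eqP.
elim: m => [|m IHm] eq0; have {}eq0' := eq0.
  move=> l; rewrite leqn0 => /eqP ->; move/(congr1 (fun p : {poly R} => p`_0)): eq0'.
  by rewrite big_ord1 coefZ lead_dfall mulr1 coef0.
have cm0 : c m.+1 = 0.
  move/(congr1 (fun p : {poly R} => p`_m.+1)): eq0'.
  rewrite coef_sum big_ord_recr big1 /= => [|i _].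
    by rewrite add0r coefZ lead_dfall mulr1 coef0.
  by rewrite coefZ nth_default ?mulr0 // size_dfall.
move=> l; rewrite leq_eqVlt => /predU1P[-> //|]; rewrite ltnS; apply: IHm.
by move: eq0; rewrite big_ord_recr /= cm0 scale0r addr0.
Qed.

(* Jindalrae-Stirling numbers of the first kind *)
Definition jstirling1 lam n k : R :=
  egf_coef (k`!%:R^-1 *: fps_comp (dlog lam) (dlog lam) ^+ k) n.

(* Type 2 degenerate Euler polynomials of order r *)
Definition deuler2 lam r n x : R :=
  egf_coef ((2 / (dexp lam 1 + dexp lam (-1))) ^+ r * dexp lam x) n.

Definition deuler2_number lam r n : R := deuler2 lam r n 0.

(* Type 2 Changhee polynomials of order r *)
Definition changhee2 r n x : R :=
  egf_coef ((2 / ((1 + fps_X R) + (1 + fps_X R)^-1)) ^+ r * binser x) n.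

Definition changhee2_number r n : R := changhee2 r n 0.

End Degenerate.

(* Main.v *)
(** Everything reduces to the composition rule [e_lam^x o log_lam = (1 + t)^x],
    which holds because both sides solve [(1 + t) f' = x f], [f 0 = 1].
    Expanding it in powers of [L = log_lam(1 + t)] and comparing polynomials in
    [x] shows that [dstirling1 lam n k] is [n!/k!] times the coefficient of t^n
    in [L ^+ k].  If [C] and [E] denote the generating functions of the Changhee
    and Euler polynomials, then [C = E o L], and the two sides of the identity
    are the n-th coefficients of [(E o L) o L] and [E o (L o L)]. *)
Require Import Defs.
From mathcomp Require Import all_boot all_order all_algebra.
From mathcomp Require Import boolp reals.
Import Order.TTheory GRing.Theory Num.Theory.
Local Open Scope ring_scope.

Set Implicit Arguments.
Unset Strict Implicit.
Unset Printing Implicit Defensive.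

(** When [g 0 = 0], the convolution with [g] loses its term of index 0; this strict decrease of the
    remaining index drives the inductions on degree. *)
Lemma ltn_subS i n : (i.+1 < n.+1)%N -> (n - i.+1 < n)%N.
Proof. by case: n => // n _; rewrite subSS ltnS leq_subr. Qed.

(** * Composition of formal power series *)

Section FpsComposition.
Variable F : fieldType.
Implicit Types f g h : fps F.

Lemma fps_coefD f g n : (f + g) n = f n + g n. Proof. by []. Qed.
Lemma fps_coefN f n : (- f) n = - f n. Proof. by []. Qed.
Lemma fps_coefZ a f n : (a *: f) n = a * f n. Proof. by []. Qed.
Lemma fps_coef1 n : (1 : fps F) n = (n == 0)%:R. Proof. by []. Qed.
Lemma fps_coefM f g n : (f * g) n = \sum_(i < n.+1) f i * g (n - i)%N.
Proof. by []. Qed.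

Lemma fps_unitE f : (f \is a GRing.unit) = (f 0 != 0).
Proof. by []. Qed.

Lemma fps_coef0M f g : (f * g) 0 = f 0 * g 0.
Proof. by rewrite fps_coefM big_ord1. Qed.

Lemma fps_coefXM f n : (fps_X F * f) n = if n is m.+1 then f m else 0.
Proof.
rewrite fps_coefM big_ord_recl /= mul0r add0r.
case: n => [|n]; first by rewrite big_ord0.
rewrite big_ord_recl /= mul1r subSS subn0 big1 ?addr0 // => i _.
by rewrite mul0r.
Qed.

Lemma fps_coef_exp_lt g k n : g 0 = 0 -> (n < k)%N -> (g ^+ k) n = 0.
Proof.
move=> g0; elim: k n => // k IHk n ltnk; rewrite exprS fps_coefM.
apply: big1 => -[[|i] /= lti] _; first by rewrite g0 mul0r.
by rewrite IHk ?mulr0 // (leq_trans (ltn_subS lti)).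
Qed.

(** The quotient (f - f(0)) / t, which serves as the tail for recursion on series. *)
Definition fps_behead f : fps F := Fps (fun n => f n.+1).

Lemma fps_beheadE f : f = (f 0)%:A + fps_X F * fps_behead f.
Proof.
apply/fpsP => -[|n]; rewrite fps_coefD fps_coefZ fps_coefXM fps_coef1 /=.
  by rewrite mulr1 addr0.
by rewrite mulr0 add0r.
Qed.

Lemma fps_comp_coef0 f g : fps_comp f g 0 = f 0.
Proof. by rewrite /= big_ord1 expr0 mulr1. Qed.

(** Horner's scheme for series: one factor [g] is pulled out of every power of positive exponent. It
    is the source of all the contraction equations below. *)
Lemma fps_comp_behead f g : g 0 = 0 ->
  fps_comp f g = (f 0)%:A + g * fps_comp (fps_behead f) g.
Proof.
move=> g0; apply/fpsP => n; rewrite fps_coefD fps_coefM /= big_ord_recl expr0.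
congr (_ + _); transitivity (\sum_(k < n) \sum_(i < n.+1)
    g i * (f k.+1 * (g ^+ k) (n - i)%N)).
  apply: eq_bigr => k _; rewrite exprS fps_coefM mulr_sumr.
  by apply: eq_bigr => i _; rewrite mulrCA.
rewrite exchange_big; apply: eq_bigr => -[[|i] /= lti] _.
  by rewrite g0 mul0r big1 // => k _; rewrite mul0r.
rewrite -mulr_sumr; congr (_ * _).
(* The left sum runs over k < n, the composition only over k <= n - i - 1. The extra terms vanish
   because [g ^+ k] has no term of degree below k. *)
have le_sub : ((n - i.+1).+1 <= n)%N by exact: ltn_subS.
rewrite (big_ord_widen n (fun k => f k.+1 * (g ^+ k) (n - i.+1)%N) le_sub).
rewrite [LHS](bigID (fun k : 'I_n => (k < (n - i.+1).+1)%N)) /=.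
rewrite [X in _ + X]big1 ?addr0 // => k; rewrite -leqNgt => ltk.
by rewrite fps_coef_exp_lt ?mulr0.
Qed.

(* Each unfolding of the equation gains one power of t, as [g 0 = 0]. This
   replaces truncation arguments in the proofs of the laws of composition. *)
Lemma fps_contraction g (D : fps F -> fps F) : g 0 = 0 ->
  (forall f, D f = g * D (fps_behead f)) -> forall f, D f = 0.
Proof.
move=> g0 DE f; apply/fpsP => n.
elim/ltn_ind: n f => n IHn f; rewrite DE fps_coefM.
apply: big1 => -[[|i] /= lti] _; first by rewrite g0 mul0r.
by rewrite IHn ?mulr0 // ltn_subS.
Qed.

Lemma fps_compD f h g : fps_comp (f + h) g = fps_comp f g + fps_comp h g.
Proof.
apply/fpsP => n; rewrite fps_coefD /= -big_split.
by apply: eq_bigr => k _; rewrite mulrDl.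
Qed.

Lemma fps_compZ a f g : fps_comp (a *: f) g = a *: fps_comp f g.
Proof.
apply/fpsP => n; rewrite fps_coefZ /= mulr_sumr.
by apply: eq_bigr => k _; rewrite mulrA.
Qed.

Lemma fps_comp1 g : fps_comp 1 g = 1.
Proof.
apply/fpsP => n; rewrite /= big_ord_recl expr0 mul1r big1 ?addr0 // => k _.
by rewrite mul0r.
Qed.

Lemma fps_compXM f g : g 0 = 0 -> fps_comp (fps_X F * f) g = g * fps_comp f g.
Proof.
move=> g0; rewrite fps_comp_behead // fps_coefXM scale0r add0r.
congr (_ * fps_comp _ _).
by apply/fpsP => n; rewrite [LHS]fps_coefXM.
Qed.

Lemma fps_compM f h g : g 0 = 0 ->
  fps_comp (f * h) g = fps_comp f g * fps_comp h g.
Proof.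
(* The difference of the two sides, as a function of [f], is the [D] of [fps_contraction]: in both
   sides the constant term of [f] contributes the same multiple of h(g(t)). *)
move=> g0; apply/subr0_eq; move: f.
apply: (fps_contraction g0) => // f.
rewrite {1}[f]fps_beheadE mulrDl -mulrA -scalerAl mul1r.
rewrite fps_compD fps_compZ fps_compXM //.
rewrite [fps_comp f g]fps_comp_behead // mulrDl -scalerAl mul1r -mulrA.
by rewrite opprD addrACA subrr add0r mulrBr.
Qed.

Lemma fps_compXn f g n : g 0 = 0 -> fps_comp (f ^+ n) g = fps_comp f g ^+ n.
Proof.
move=> g0; elim: n => [|n IHn]; first by rewrite !expr0 fps_comp1.
by rewrite !exprS fps_compM // IHn.
Qed.

Lemma fps_compV f g : g 0 = 0 -> f 0 != 0 ->
  fps_comp f^-1 g = (fps_comp f g)^-1.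
Proof.
move=> g0 f0; have fV : fps_comp f^-1 g * fps_comp f g = 1.
  by rewrite -fps_compM // mulVr ?fps_comp1.
have fU : fps_comp f g \is a GRing.unit.
  by rewrite fps_unitE fps_comp_coef0.
by apply: (mulIr fU); rewrite fV mulVr.
Qed.

Lemma fps_compA f g h : g 0 = 0 -> h 0 = 0 ->
  fps_comp (fps_comp f g) h = fps_comp f (fps_comp g h).
Proof.
move=> g0 h0; apply/subr0_eq; move: f.
have gh0 : fps_comp g h 0 = 0 by rewrite fps_comp_coef0.
(* Here the factor gained at each unfolding is g(h(t)), not [g]. *)
apply: (fps_contraction gh0) => f.
rewrite (fps_comp_behead f g0) (fps_comp_behead f gh0).
by rewrite fps_compD fps_compM // fps_compZ fps_comp1 opprD addrACA subrr add0r mulrBr.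
Qed.

(** * Formal derivative and the chain rule *)

Definition fps_deriv f : fps F := Fps (fun n => f n.+1 *+ n.+1).

Lemma fps_derivD f g : fps_deriv (f + g) = fps_deriv f + fps_deriv g.
Proof. by apply/fpsP => n /=; rewrite mulrnDl. Qed.

Lemma fps_derivZ a f : fps_deriv (a *: f) = a *: fps_deriv f.
Proof. by apply/fpsP => n /=; rewrite mulrnAr. Qed.

Lemma fps_deriv1 : fps_deriv 1 = 0.
Proof. by apply/fpsP => n /=; rewrite mul0rn. Qed.

Lemma fps_derivX : fps_deriv (fps_X F) = 1.
Proof. by apply/fpsP => -[|n] /=; rewrite ?mul0rn. Qed.

Lemma fps_derivM f g :
  fps_deriv (f * g) = fps_deriv f * g + f * fps_deriv g.
Proof.
apply/fpsP => n; rewrite fps_coefD {1}/fps_deriv [LHS]/= -sumrMnl.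
(* The weight n + 1 splits as i + (n + 1 - i), one share for each factor. *)
transitivity (\sum_(i < n.+2) (f i *+ i) * g (n.+1 - i)%N
   + \sum_(i < n.+2) f i * (g (n.+1 - i)%N *+ (n.+1 - i))).
  rewrite -big_split; apply: eq_bigr => i _ /=.
  by rewrite mulrnAl mulrnAr -mulrnDr subnKC // -ltnS.
congr (_ + _).
  by rewrite big_ord_recl mulr0n mul0r add0r.
rewrite big_ord_recr /= subnn mulr0n mulr0 addr0.
by apply: eq_bigr => i _; rewrite subSn // -ltnS.
Qed.

Lemma fps_deriv_comp f g : g 0 = 0 ->
  fps_deriv (fps_comp f g) = fps_comp (fps_deriv f) g * fps_deriv g.
Proof.
move=> g0; apply/subr0_eq; move: f.
apply: (fps_contraction g0) => // f.
have -> : fps_deriv f = fps_behead f + fps_X F * fps_deriv (fps_behead f).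
  rewrite {1}[f]fps_beheadE fps_derivD fps_derivZ fps_deriv1 scaler0 add0r.
  by rewrite fps_derivM fps_derivX mul1r.
rewrite (fps_comp_behead f g0) fps_derivD fps_derivZ fps_deriv1 scaler0 add0r.
rewrite fps_derivM fps_compD fps_compXM // mulrDl.
by rewrite [fps_deriv g * _]mulrC opprD addrACA subrr add0r mulrBr mulrA.
Qed.

End FpsComposition.

(** * Degenerate exponential, binomial series and logarithm *)

Section Degenerate.
Variable R : realType.
Implicit Types (lam x : R) (r n k : nat).

Lemma dfallS (A : nzRingType) (l x : A) n :
  dfall l x n.+1 = dfall l x n * (x - l *+ n).
Proof. by rewrite /dfall big_ord_recr. Qed.

Lemma dfall0 (A : nzRingType) (l x : A) : dfall l x 0 = 1.
Proof. by rewrite /dfall big_ord0. Qed.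

Lemma dexp_coef0 lam x : dexp lam x 0 = 1.
Proof. by rewrite /= dfall0 divr1. Qed.

Lemma dexpSE lam x n :
  dexp lam x n.+1 *+ n.+1 = (x - lam *+ n) * dexp lam x n.
Proof.
rewrite /= dfallS factS natrM -[LHS]mulr_natr invfM -[LHS]mulrA.
rewrite [_^-1 * _ * _]mulrAC mulVf ?pnatr_eq0 // mul1r.
by rewrite [dfall _ _ _ * _]mulrC mulrA.
Qed.

Lemma dexp_ode lam x :
  (1 + lam *: fps_X R) * fps_deriv (dexp lam x) = x *: dexp lam x.
Proof.
apply/fpsP => n; rewrite mulrDl mul1r -scalerAl fps_coefD !fps_coefZ fps_coefXM.
rewrite -[fps_deriv _ n]/(dexp lam x n.+1 *+ n.+1) dexpSE.
case: n => [|n]; first by rewrite mulr0n subr0 mulr0 addr0.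
rewrite -[fps_deriv _ n]/(dexp lam x n.+1 *+ n.+1).
by rewrite mulrnAr -mulrnAl mulrBl subrK.
Qed.

Lemma binserE x : binser x = dexp 1 x.
Proof. by []. Qed.

Lemma binser_ode x : (1 + fps_X R) * fps_deriv (binser x) = x *: binser x.
Proof. by rewrite -[fps_X R]scale1r binserE dexp_ode. Qed.

(** The equation amounts to the recurrence (n + 1) f_{n+1} = (x - n) f_n, and n + 1 can be cancelled
    in characteristic 0. *)
Lemma binser_unique x (f : fps R) :
  f 0 = 1 -> (1 + fps_X R) * fps_deriv f = x *: f -> f = binser x.
Proof.
move=> f0 odef; apply/fpsP; elim=> [|n IHn]; first by rewrite f0 dexp_coef0.
have rec (h : fps R) : (1 + fps_X R) * fps_deriv h = x *: h ->
    h n.+1 *+ n.+1 = (x - n%:R) * h n.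
  move/fpsP/(_ n); rewrite mulrDl mul1r fps_coefD fps_coefXM fps_coefZ.
  case: n {IHn} => [|m]; first by rewrite addr0 subr0.
  by rewrite mulrBl => <-; rewrite [_%:R * _]mulr_natl addrK.
have : f n.+1 *+ n.+1 = binser x n.+1 *+ n.+1.
  by rewrite !rec ?IHn //; apply: binser_ode.
by move/eqP; rewrite eqrMn2r //= => /eqP.
Qed.

Lemma binserD x y : binser (x + y) = binser x * binser y.
Proof.
symmetry; apply: binser_unique; first by rewrite fps_coef0M !dexp_coef0 mulr1.
rewrite fps_derivM mulrDr mulrA binser_ode [binser x * _]mulrC mulrA.
by rewrite binser_ode -!scalerAl [binser y * _]mulrC scalerDl.
Qed.

Lemma binser0 : binser 0 = 1 :> fps R.
Proof. by symmetry; apply: binser_unique; rewrite // fps_deriv1 mulr0 scale0r. Qed.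

Lemma binser1 : binser 1 = 1 + fps_X R.
Proof.
symmetry; apply: binser_unique; first by rewrite fps_coefD /= addr0.
by rewrite fps_derivD fps_deriv1 fps_derivX add0r mulr1 scale1r.
Qed.

Lemma binserN x : binser (- x) = (binser x)^-1.
Proof.
have xU : binser x \is a GRing.unit.
  by rewrite fps_unitE dexp_coef0 oner_eq0.
by apply: (mulIr xU); rewrite mulVr // -binserD addNr binser0.
Qed.

Lemma dlog_coef0 lam : dlog lam 0 = 0.
Proof.
by rewrite fps_coefZ fps_coefD fps_coefN dexp_coef0 subrr mulr0.
Qed.

Lemma dexp_comp_dlog lam x : lam != 0 ->
  fps_comp (dexp lam x) (dlog lam) = binser x.
Proof.
move=> lam0; have L0 := dlog_coef0 lam.
apply: binser_unique; first by rewrite fps_comp_coef0 dexp_coef0.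
have lamL : 1 + lam *: dlog lam = binser lam.
  by rewrite /dlog scalerA divff // scale1r addrC subrK.
(* With L = log_lam(1 + t), the factor 1 + lam t in the equation of e_lam^x becomes 1 + lam L under
   substitution, which is exactly (1 + t) L'. The chain rule then gives the equation of (1 +
   t)^x. *)
have odeL : (1 + fps_X R) * fps_deriv (dlog lam) = 1 + lam *: dlog lam.
  rewrite lamL /dlog fps_derivZ fps_derivD -scaleN1r fps_derivZ fps_deriv1.
  by rewrite scaler0 addr0 mulrC -scalerAl mulrC binser_ode scalerA mulVf // scale1r.
rewrite fps_deriv_comp // mulrCA odeL mulrC -fps_compZ -dexp_ode.
rewrite fps_compM // fps_compD fps_comp1 fps_compZ; congr ((1 + _ *: _) * _).
by rewrite -[fps_X R]mulr1 fps_compXM // fps_comp1 mulr1.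
Qed.

(** * Stirling numbers as coefficients of powers of the logarithm *)

Lemma poly_horner_inj (p q : {poly R}) : (forall x, p.[x] = q.[x]) -> p = q.
Proof.
move=> pq; apply/subr0_eq/eqP/negPn/negP => d0.
(* The naturals below the size of [p - q] are distinct roots, too many for a nonzero polynomial. *)
pose rs : seq R := [seq i%:R | i <- iota 0 (size (p - q))].
suff : (size rs < size (p - q)%R)%N by rewrite size_map size_iota ltnn.
apply: max_poly_roots => //.
  by apply/allP => x _; rewrite rootE hornerD hornerN pq subrr.
by rewrite map_inj_uniq ?iota_uniq // => i j /eqP; rewrite eqr_nat => /eqP.
Qed.

Lemma horner_dfall lam x n :
  (dfall lam%:P ('X : {poly R}) n).[x] = dfall lam x n.
Proof.
rewrite /dfall horner_prod; apply: eq_bigr => i _.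
by rewrite -polyCMn hornerXsubC.
Qed.

Lemma dstirling1E lam n k : lam != 0 -> (k <= n)%N ->
  dstirling1 lam n k = n`!%:R / k`!%:R * (dlog lam ^+ k) n.
Proof.
move=> lam0 le_kn; symmetry.
apply: (dstirling1_unique (s := fun k => n`!%:R / k`!%:R * (dlog lam ^+ k) n)) => //.
rewrite /fall -polyC1; apply: poly_horner_inj => x.
rewrite horner_sum horner_dfall -[dfall 1 x n]/(fall x n).
have fact0 : n`!%:R != 0 :> R by rewrite pnatr_eq0 -lt0n fact_gt0.
(* In degree n this expands (x)_n / n! in the (x)_{k,lam} / k!, with the coefficients of
   [dlog lam ^+ k] as weights. *)
have /fpsP/(_ n)/= binE := dexp_comp_dlog x lam0.
rewrite -[LHS](divfK fact0) -binE mulr_suml; apply: eq_bigr => l _; rewrite hornerZ horner_dfall.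
by rewrite mulrC -!mulrA; congr (_ * _); rewrite mulrC -!mulrA.
Qed.

(** Summing against these numbers is substitution of log_lam(1 + t): the k! of [egf_coef] cancels
    the 1/k! of the Stirling number. *)
Lemma sum_dstirling1 lam n (f : fps R) : lam != 0 ->
  \sum_(k < n.+1) egf_coef f k * dstirling1 lam n k
  = egf_coef (fps_comp f (dlog lam)) n.
Proof.
move=> lam0; rewrite /egf_coef /= mulr_sumr; apply: eq_bigr => k _.
have fact0 : k`!%:R != 0 :> R by rewrite pnatr_eq0 -lt0n fact_gt0.
rewrite dstirling1E // -1?ltnS // [k`!%:R * _]mulrC [_ / _]mulrC -!mulrA.
by rewrite mulVKf // mulrCA.
Qed.

Lemma sum_jstirling1 lam n (f : fps R) :
  \sum_(k < n.+1) egf_coef f k * jstirling1 lam n k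
  = egf_coef (fps_comp f (fps_comp (dlog lam) (dlog lam))) n.
Proof.
rewrite /egf_coef [fps_comp f _ n]/= mulr_sumr; apply: eq_bigr => k _.
have fact0 : k`!%:R != 0 :> R by rewrite pnatr_eq0 -lt0n fact_gt0.
rewrite /jstirling1 /egf_coef fps_coefZ mulrCA.
by congr (_ * _); rewrite [k`!%:R * _]mulrC -mulrA mulVKf.
Qed.

Lemma deuler2_comp_dlog lam r x : lam != 0 ->
  fps_comp ((2 / (dexp lam 1 + dexp lam (-1))) ^+ r * dexp lam x) (dlog lam)
  = (2 / ((1 + fps_X R) + (1 + fps_X R)^-1)) ^+ r * binser x.
Proof.
move=> lam0; have L0 := dlog_coef0 lam.
rewrite fps_compM // fps_compXn // fps_compM // fps_compV //; last first.
  (* The denominator has constant term 2, hence is a unit, and its inverse is compatible with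
     substitution. *)
  by rewrite fps_coefD !dexp_coef0 -[1 + 1]/(2%:R) pnatr_eq0.
by rewrite !fps_compD fps_comp1 !dexp_comp_dlog // binserN binser1.
Qed.

End Degenerate.

Theorem theorem6 (R : realType) (lam : R) (r n : nat) :
  lam != 0 -> (0 < r)%N ->
  (forall x : R,
     \sum_(k < n.+1) changhee2 r k x * dstirling1 lam n k
     = \sum_(k < n.+1) deuler2 lam r k x * jstirling1 lam n k)
  /\ \sum_(k < n.+1) changhee2_number R r k * dstirling1 lam n k
     = \sum_(k < n.+1) deuler2_number lam r k * jstirling1 lam n k.
Proof.
move=> lam0 _; suff thm x :
    \sum_(k < n.+1) changhee2 r k x * dstirling1 lam n k
    = \sum_(k < n.+1) deuler2 lam r k x * jstirling1 lam n k.
  by split; [exact: thm | exact: thm 0].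
rewrite sum_dstirling1 // sum_jstirling1 -fps_compA ?dlog_coef0 //.
by rewrite deuler2_comp_dlog.
Qed.
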